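(* Let $a,b$ be positive integers and let $v=ab+1$. Then the multigraph $2K_v$ has a cyclic $K_{a,b}$-decomposition.
   Context: $K_v$ is the complete graph on $v$ vertices, $K_{a,b}$ is the complete bipartite graph with parts of sizes $a$ and $b$, and for a graph $\Gamma$, $\lambda\Gamma$ is the multigraph obtained by assigning each edge of $\Gamma$ multiplicity $\lambda$. An $H$-decomposition of a (multi)graph $\Gamma$ is a partition of the edge (multi)set of $\Gamma$ into $|E(\Gamma)|/|E(H)|$ subgraphs, each isomorphic to $H$ (the subgraphs are taken as an indexed family, i.e. a multiset of blocks). An $H$-decomposition of $\Gamma$ is cyclic if it admits an automorphism (a permutation of the vertices of $\Gamma$ mapping the multiset of subgraphs of the decomposition to itself) that cyclically permutes all of the vertices of $\Gamma$, i.e. acts as a single cycle on the vertex set. *)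

(* Defs.v *)
From mathcomp Require Import all_boot all_fingroup.

Set Implicit Arguments.
Unset Strict Implicit.
Unset Printing Implicit Defensive.

Record sgraph (T : finType) := SGraph {
  edges :> {set {set T}};
  edges_card : forall e, e \in edges -> #|e| = 2
}.

Record mgraph (T : finType) := MGraph {
  mult :> {set T} -> nat;
  mult_card : forall e, 0 < mult e -> #|e| = 2
}.

Definition msize (T : finType) (G : mgraph T) : nat := \sum_(e : {set T}) G e.

Lemma scale_card (T : finType) (l : nat) (G : sgraph T) (e : {set T}) :
  0 < (if e \in G then l else 0) -> #|e| = 2.
Proof. by case: ifP => // /edges_card. Qed.

Definition scale_graph (T : finType) (l : nat) (G : sgraph T) : mgraph T :=
  MGraph (@scale_card T l G).

Lemma complete_card (v : nat) (e : {set 'I_v}) :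
  e \in [set e : {set 'I_v} | #|e| == 2] -> #|e| = 2.
Proof. by rewrite inE => /eqP. Qed.

Definition complete_graph (v : nat) : sgraph 'I_v :=
  SGraph (@complete_card v).

Lemma complete_bipartite_card (a b : nat) (e : {set 'I_a + 'I_b}) :
  e \in [set [set inl i; inr j] | i : 'I_a, j : 'I_b] -> #|e| = 2.
Proof. by case/imset2P => i j _ _ ->; rewrite cards2. Qed.

Definition complete_bipartite (a b : nat) : sgraph ('I_a + 'I_b)%type :=
  SGraph (@complete_bipartite_card a b).

(* A subgraph on a subset of T: its vertex set and its edge set. *)
Definition block (T : finType) : Type := ({set T} * {set {set T}})%type.

Definition edge_image (U T : finType) (f : U -> T) (E : {set {set U}}) :
  {set {set T}} := [set f @: (e : {set U}) | e in E].

(* f, corestricted to its image, is an isomorphism from H onto B. *)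
Definition isomorphic_to (U T : finType) (H : sgraph U) (B : block T) : Prop :=
  exists f : U -> T,
    [/\ injective f, B.1 = f @: [set: U] & B.2 = edge_image f H].

(* Multisets of blocks are sequences up to perm_eq. The last clause makes the
   edge multiset of G the sum of the edge sets of the blocks; in particular it
   forces every edge of a block to be an edge of G. *)
Definition is_decomposition (U T : finType) (H : sgraph U) (G : mgraph T)
    (D : seq (block T)) : Prop :=
  [/\ size D * #|edges H| = msize G,
      forall B, B \in D -> isomorphic_to H B
    & forall e : {set T}, count (fun B : block T => e \in B.2) D = G e].

Definition block_image (T : finType) (s : {perm T}) (B : block T) : block T :=
  (s @: B.1, edge_image s B.2).

Definition is_automorphism (T : finType) (s : {perm T}) (D : seq (block T)) :
  Prop := perm_eq (map (block_image s) D) D.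

Definition is_full_cycle (T : finType) (s : {perm T}) : Prop :=
  forall x : T, porbit s x = [set: T].

Definition has_cyclic_decomposition (U T : finType) (H : sgraph U)
    (G : mgraph T) : Prop :=
  exists D : seq (block T),
    is_decomposition H G D /\
    exists s : {perm T}, is_full_cycle s /\ is_automorphism s D.

(* Main.v *)
Require Import Defs.
From mathcomp Require Import all_boot all_fingroup.
From mathcomp Require Import ssralg zmodp zify.

(** Label the parts of [K_{a,b}] by [0, ..., a - 1] and [a, 2a, ..., ba] in
    [Z_v].  The differences [a(j + 1) - i] run exactly once through the nonzero
    residues modulo [v = ab + 1], so among the [v] translates of this copy of
    [K_{a,b}] each pair [{y, z}] is covered once through the difference [z - y]
    and once through [y - z]; translation by [1] is the cyclic automorphism. *)

Set Implicit Arguments.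
Unset Strict Implicit.
Unset Printing Implicit Defensive.

Import GRing.Theory.

Lemma edge_image_comp (U V W : finType) (g : V -> W) (f : U -> V)
    (E : {set {set U}}) :
  edge_image g (edge_image f E) = edge_image (g \o f) E.
Proof.
by rewrite /edge_image -imset_comp; apply: eq_imset => e /=; rewrite imset_comp.
Qed.

Lemma card_edge_image (U V : finType) (f : U -> V) (E : {set {set U}}) :
  injective f -> #|edge_image f E| = #|E|.
Proof. by move=> f_inj; apply: card_imset; apply: imset_inj. Qed.

(* The size condition of a decomposition is a consequence of the other two, by
   double counting the pairs (edge, block). *)
Lemma is_decompositionI (U T : finType) (H : sgraph U) (G : mgraph T)
    (D : seq (block T)) :
  (forall B, B \in D -> isomorphic_to H B) ->
  (forall e : {set T}, count (fun B : block T => e \in B.2) D = G e) ->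
  is_decomposition H G D.
Proof.
move=> isoD countD; split=> //; rewrite /msize.
under eq_bigr do rewrite -countD -sum1_count big_mkcond.
rewrite exchange_big /= mulnC -iter_addn_0 -(count_predT D) -big_const_seq.
rewrite big_seq [RHS]big_seq.
apply: eq_bigr => B /isoD[f [f_inj _ ->]].
by rewrite -(card_edge_image _ f_inj) -sum1_card [LHS]big_mkcond.
Qed.

(** * Developing one labelled block through the cyclic group of order [n.+1] *)

Section Develop.

Variables (n a b : nat) (h : 'I_a + 'I_b -> 'I_n.+1).
Local Open Scope ring_scope.
Implicit Types (x y z : 'I_n.+1) (i : 'I_a) (j : 'I_b).

Definition translate_label x (u : 'I_a + 'I_b) : 'I_n.+1 := h u + x.

Definition translate_block x : block 'I_n.+1 :=
  (translate_label x @: [set: 'I_a + 'I_b],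
   edge_image (translate_label x) (complete_bipartite a b)).

(** Indexed by all shifts, so that coinciding translates stay as repeated blocks; for [a = b = 1]
    the two translates in $Z_2$ do coincide. *)
Definition development : seq (block 'I_n.+1) :=
  map translate_block (enum 'I_n.+1).

Definition translation y : {perm 'I_n.+1} := perm (addIr y).

Lemma translate_blockD x y :
  block_image (translation y) (translate_block x) = translate_block (x + y).
Proof.
have tD : translation y \o translate_label x =1 translate_label (x + y).
  by move=> u /=; rewrite permE /translate_label addrA.
rewrite /block_image /translate_block /= -imset_comp edge_image_comp.
congr pair; first exact: eq_imset.
by apply: eq_imset => e; apply: eq_imset.
Qed.

(** Translating by [y] only reindexes the family along the bijection $x \mapsto x + y$. *)
Lemma development_automorphism y : is_automorphism (translation y) development.
Proof.
rewrite /is_automorphism /development -map_comp.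
rewrite (eq_map (g := translate_block \o +%R^~ y)) => [|x /=]; last first.
  exact: translate_blockD.
rewrite map_comp; apply: perm_map; apply: uniq_perm.
- by rewrite (map_inj_uniq (addIr y)) enum_uniq.
- exact: enum_uniq.
move=> x; rewrite mem_enum; apply/mapP; exists (x - y); rewrite ?mem_enum //.
by rewrite subrK.
Qed.

Lemma translation_full_cycle : is_full_cycle (translation (inZp 1)).
Proof.
move=> x; apply/setP=> y; rewrite inE.
(* The exponent is the residue [y - x] read as a natural number. *)
suff -> : y = (translation (inZp 1) ^+ (y - x)%R)%g x by apply: mem_porbit.
have tX k : (translation (inZp 1) ^+ k)%g x = x + inZp k.
  elim: k => [|k IHk].
    by rewrite expg0 perm1 (_ : inZp 0 = 0) ?addr0 //; apply: val_inj.
  rewrite expgSr permM IHk permE -addrA; congr (_ + _).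
  by apply: val_inj; rewrite /= modnDm addn1.
by rewrite tX valZpK addrC subrK.
Qed.

Lemma mem_translate_block x (e : {set 'I_n.+1}) :
  reflect (exists i j, e = [set h (inl i) + x; h (inr j) + x])
          (e \in (translate_block x).2).
Proof.
apply: (iffP imsetP) => [[_ /imset2P[i j _ _ ->] ->]|[i [j ->]]].
  by exists i, j; rewrite imsetU1 imset_set1.
exists [set inl i; inr j]; last by rewrite imsetU1 imset_set1.
by apply/imset2P; exists i j.
Qed.

Hypothesis diff_neq0 : forall i j, h (inr j) != h (inl i).
Hypothesis diff_inj :
  injective (fun p : 'I_a * 'I_b => h (inr p.2) - h (inl p.1)).
Hypothesis diff_surj :
  forall z, z != 0 -> exists i j, h (inr j) - h (inl i) = z.

(** Two vertices of one part are compared through their edges to a common vertex of the other part,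
    which must therefore be nonempty. *)
Lemma label_inj : (0 < a)%N -> (0 < b)%N -> injective h.
Proof.
move=> a_gt0 b_gt0 [i|j] [i'|j'] eq_h.
- have [-> //] : (i, Ordinal b_gt0) = (i', Ordinal b_gt0).
  by apply: diff_inj; rewrite /= eq_h.
- by have := diff_neq0 i j'; rewrite eq_h eqxx.
- by have := diff_neq0 i' j; rewrite eq_h eqxx.
- have [-> //] : (Ordinal a_gt0, j) = (Ordinal a_gt0, j').
  by apply: diff_inj; rewrite /= eq_h.
Qed.

Lemma translate_edge y z i j : h (inr j) - h (inl i) = z - y ->
  h (inr j) + (y - h (inl i)) = z.
Proof. by move=> dij; rewrite addrCA dij addrC subrK. Qed.

(** The shift cancels in [z - y], so the difference identifies the edge, and the edge then
    determines the shift. *)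
Lemma translate_unique x y z i i' j j' : h (inr j) - h (inl i) = z - y ->
  y = h (inl i') + x -> z = h (inr j') + x -> x = y - h (inl i).
Proof.
move=> dij y_eq z_eq; have [-> _] : (i, j) = (i', j').
  by apply: diff_inj; rewrite /= dij z_eq y_eq opprD addrACA subrr addr0.
by rewrite y_eq addrC addKr.
Qed.

Lemma count_development (e : {set 'I_n.+1}) :
  count (fun B : block 'I_n.+1 => e \in B.2) development
    = scale_graph 2 (complete_graph n.+1) e.
Proof.
rewrite count_map -size_filter /= inE.
rewrite (_ : size _ = #|[set x | e \in (translate_block x).2]|); last first.
  rewrite cardsE cardE /enum_mem !size_filter.
  by rewrite count_filter; apply: eq_count => x; rewrite /= andbT.
case: ifPn => [/cards2P[y [z [neq_yz ->]]]|e_n2]; last first.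
  apply/eqP; rewrite cards_eq0; apply/eqP/setP=> x; rewrite !inE.
  apply: contraNF e_n2.
  case/mem_translate_block=> i [j ->]; rewrite cards2.
  by rewrite (inj_eq (addIr x)) [_ == h _]eq_sym diff_neq0.
have [i [j dij]] : exists i j, h (inr j) - h (inl i) = z - y.
  by apply: diff_surj; rewrite subr_eq0 eq_sym.
have [i' [j' dij']] : exists i j, h (inr j) - h (inl i) = y - z.
  by apply: diff_surj; rewrite subr_eq0.
(* One shift for each orientation: the first sends [inl i] to [y], the second sends [inl i'] to
   [z]. *)
have -> : [set x | [set y; z] \in (translate_block x).2]
    = [set y - h (inl i); z - h (inl i')].
  apply/setP=> x; rewrite !inE; apply/mem_translate_block/orP.
    case=> k [l eq_yz].
    have := set22 y z; have := set21 y z; rewrite eq_yz.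
    case/set2P=> y_eq /set2P[] z_eq.
    - by rewrite y_eq z_eq eqxx in neq_yz.
    - by left; apply/eqP; apply: translate_unique dij y_eq z_eq.
    - by right; apply/eqP; apply: translate_unique dij' z_eq y_eq.
    - by rewrite y_eq z_eq eqxx in neq_yz.
  case=> /eqP ->.
    by exists i, j; rewrite (translate_edge dij) addrC subrK.
  by exists i', j'; rewrite (translate_edge dij') [_ + (_ - _)]addrC subrK setUC.
(* Were the two shifts equal, [inr j] and [inl i'] would both land on [z] and so share a label. *)
rewrite cards2; case: eqP => // eq_x.
have := diff_neq0 i' j; case/eqP.
apply: (addIr (z - h (inl i'))).
by rewrite -{1}eq_x (translate_edge dij) addrC subrK.
Qed.

Lemma development_decomposition : (0 < a)%N -> (0 < b)%N ->
  is_decomposition (complete_bipartite a b)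
    (scale_graph 2 (complete_graph n.+1)) development.
Proof.
move=> a_gt0 b_gt0; apply: is_decompositionI count_development.
move=> _ /mapP[x _ ->]; exists (translate_label x); split=> //.
by move=> u w /addIr; apply: label_inj.
Qed.

End Develop.

(** * The explicit labelling and its differences *)

Section Label.

Variables a b : nat.
Implicit Types (i : 'I_a) (j : 'I_b).

Definition bipartite_label (u : 'I_a + 'I_b) : 'I_(a * b).+1 :=
  match u with inl i => inZp i | inr j => inZp (a * j.+1) end.

Lemma bipartite_label_diff i j :
  (bipartite_label (inr j) - bipartite_label (inl i))%R
    = inZp (a * j.+1 - i).
Proof.
apply/eqP; rewrite subr_eq; apply/eqP; apply: val_inj.
rewrite /= modnDm subnK //.
by apply: leq_trans (ltnW (ltn_ord i)) _; rewrite leq_pmulr.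
Qed.

Lemma bipartite_diff_bounds i j : 0 < a * j.+1 - i <= a * b.
Proof. have := ltn_ord i; have := ltn_ord j; nia. Qed.

(** The bounds exclude any wraparound modulo [(a * b).+1], so the remaining arguments take place in
    the natural numbers. *)
Lemma bipartite_label_diff_val i j :
  nat_of_ord (bipartite_label (inr j) - bipartite_label (inl i))%R
    = a * j.+1 - i.
Proof.
rewrite bipartite_label_diff /= modn_small // ltnS.
by case/andP: (bipartite_diff_bounds i j).
Qed.

Lemma bipartite_label_diff_neq0 i j :
  bipartite_label (inr j) != bipartite_label (inl i).
Proof.
rewrite -subr_eq0 -val_eqE /= -lt0n.
have := bipartite_label_diff_val i j; rewrite /= => ->.
by case/andP: (bipartite_diff_bounds i j).
Qed.

Lemma bipartite_label_diff_inj :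
  injective (fun p : 'I_a * 'I_b =>
    bipartite_label (inr p.2) - bipartite_label (inl p.1))%R.
Proof.
move=> [i j] [i' j'] /(congr1 (@nat_of_ord _)).
rewrite !bipartite_label_diff_val /= => eq_d.
have lt_i := ltn_ord i; have lt_i' := ltn_ord i'.
(* Since $0 \le i < a$, the difference lies in the interval $(aj, a(j+1)]$, and these intervals are
   disjoint for distinct [j]. *)
have eq_j : j = j' :> nat.
  by case: (ltngtP j j') => // /(leq_mul (leqnn a)); lia.
have eq_i : i = i' :> nat by rewrite eq_j in eq_d; lia.
by congr pair; apply: val_inj.
Qed.

Lemma bipartite_label_diff_surj (d : 'I_(a * b).+1) : d != 0%R ->
  exists i j, (bipartite_label (inr j) - bipartite_label (inl i))%R = d.
Proof.
rewrite -val_eqE /= => d_neq0; have lt_d := ltn_ord d.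
have a_gt0 : 0 < a by nia.
(* Write $d - 1 = aq + r$ with $r < a$; then $d = a(q+1) - (a - (r+1))$, which gives $j = q$ and $i
   = a - (r+1)$. *)
have lt_i : a - (d.-1 %% a).+1 < a by lia.
have lt_j : d.-1 %/ a < b by rewrite ltn_divLR //; lia.
exists (Ordinal lt_i), (Ordinal lt_j); apply: val_inj.
have := bipartite_label_diff_val (Ordinal lt_i) (Ordinal lt_j); rewrite /= => ->.
have := divn_eq d.-1 a; have := ltn_pmod d.-1 a_gt0.
nia.
Qed.

End Label.

Theorem mainTheorem11 (a b v : nat) (ha : 0 < a) (hb : 0 < b)
    (hv : v = a * b + 1) :
  has_cyclic_decomposition (complete_bipartite a b)
    (scale_graph 2 (complete_graph v)).
Proof.
(* The successor form of [v] gives the vertex type its addition modulo [v]. *)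
rewrite {v}hv addn1; exists (development (@bipartite_label a b)); split.
  apply: development_decomposition ha hb.
  - exact: bipartite_label_diff_neq0.
  - exact: bipartite_label_diff_inj.
  - exact: bipartite_label_diff_surj.
exists (translation (inZp 1)); split; first exact: translation_full_cycle.
exact: development_automorphism.
Qed.
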